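(* For every constant $k$, no deterministic width-$k$ online bipartite matching algorithm can achieve an asymptotic approximation ratio greater than $1/2$.
   Context: Online one-sided bipartite matching: offline vertices are known in advance; online vertices arrive one at a time in adversarial order, each with its set of offline neighbours, and the algorithm must irrevocably match it to an unmatched neighbour or leave it unmatched; the goal is a maximum-size matching. Width-$k$ model: the algorithm maintains a tree of partial matchings with the empty matching as root at level 0; when the $i$-th online vertex arrives, each node at level $i-1$ gets at least one child (no cutting), each child extending the parent matching by a decision for this vertex; every level contains at most $k$ nodes; the output is the largest matching at the final level. The asymptotic approximation ratio of $\mathbb{A}$ is $\liminf_{n}\inf_{I\in\mathcal{I}_n} v(\mathbb{A},I)/v(I)$, where $\mathcal{I}_n$ are instances of size $n$ and $v(I)$ is the maximum matching size. *)

(* Defs.v *)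
From mathcomp Require Import all_boot all_order all_algebra.
Set Implicit Arguments. Unset Strict Implicit. Unset Printing Implicit Defensive.
Import Order.TTheory GRing.Theory Num.Theory.

(* Online one-sided bipartite matching, width-k model.

   An instance is a pair (m, I):
   - offline vertices are 0, ..., m-1 (known in advance);
   - I : seq (seq nat) is the sequence of online vertices in arrival order,
     each given by the list of its offline neighbours.
   A (partial) matching for a prefix of the online vertices is encoded as a
   decision list [pm : seq (option nat)]: the i-th entry is [Some j] if the
   i-th online vertex is matched to offline vertex j, [None] if it is left
   unmatched. *)

Definition instance_wf (m : nat) (I : seq (seq nat)) : bool :=
  all (all (fun j => j < m)) I.

Definition valid_dec (nb : seq nat) (d : option nat) : bool :=
  if d is Some j then j \in nb else true.

Definition is_matching (I : seq (seq nat)) (pm : seq (option nat)) : bool :=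
  [&& size pm == size I, all2 valid_dec I pm & uniq (pmap id pm)].

Definition msize (pm : seq (option nat)) : nat := count isSome pm.

Fixpoint all_decisions (I : seq (seq nat)) : seq (seq (option nat)) :=
  match I with
  | [::] => [:: [::]]
  | nb :: I' => [seq d :: r | d <- None :: map Some nb, r <- all_decisions I']
  end.

Definition opt_value (I : seq (seq nat)) : nat :=
  \max_(pm <- all_decisions I | is_matching I pm) msize pm.

(* A deterministic width-k algorithm.  When the (i+1)-th online vertex
   arrives, the algorithm sees the number m of offline vertices and the
   neighbour lists of the online vertices seen so far (including the new
   one); it outputs, for each node of the current level (in order), the list
   of decisions for the new vertex defining the children of that node.
   Being a function of the history only, it is online and deterministic
   (the current tree is itself determined by the history). *)
Definition Alg := nat -> seq (seq nat) -> seq (seq (option nat)).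

Definition expand (L : seq (seq (option nat))) (C : seq (seq (option nat)))
  : seq (seq (option nat)) :=
  flatten [seq [seq rcons pc.1 d | d <- pc.2] | pc <- zip L C].

Fixpoint level (A : Alg) (m : nat) (I : seq (seq nat)) (i : nat)
  : seq (seq (option nat)) :=
  match i with
  | 0 => [:: [::]]
  | i'.+1 => expand (level A m I i') (A m (take i'.+1 I))
  end.

Definition width_k_alg (k : nat) (A : Alg) : Prop :=
  forall (m : nat) (I : seq (seq nat)), instance_wf m I ->
    (forall i, i < size I ->
       let L := level A m I i in
       let C := A m (take i.+1 I) in
       [/\ size C = size L,
           all (fun ds => ds != [::]) C &
           all (is_matching (take i.+1 I)) (expand L C)]) /\
    (forall i, i <= size I -> size (level A m I i) <= k).

Definition alg_value (A : Alg) (m : nat) (I : seq (seq nat)) : nat :=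
  \max_(pm <- level A m I (size I)) msize pm.

(* Instance size n = number of online vertices.  The asymptotic
   approximation ratio liminf_n inf_{I in I_n} v(A,I)/v(I) is <= r, written
   out: for every eps > 0 and every N there is an instance of size n >= N
   (with v(I) > 0) whose ratio is < r + eps. *)
Definition asymptotic_ratio_le (A : Alg) (r : rat) : Prop :=
  forall eps : rat, (0 < eps)%R -> forall N : nat,
    exists (m : nat) (I : seq (seq nat)),
      [/\ instance_wf m I, (N <= size I)%N, (0 < opt_value I)%N &
          (((alg_value A m I)%:R / (opt_value I)%:R : rat) < r + eps)%R].

(* Main.v *)
Require Import Defs.
From mathcomp Require Import all_boot all_order all_algebra.
From mathcomp Require Import zify lra.

Import Order.TTheory GRing.Theory Num.Theory.

(** The adversary keeps a set of "alive" offline vertices, initially all [m] of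
    them.  Two alive vertices are equivalent when every node of the current
    level uses both or neither; there are at most [2 ^ k] classes, so as long as
    more than [k * 2 ^ k] vertices are alive some class [S] has more than [k]
    elements.  The next online vertex [v] is adjacent to exactly [S].  Some [x]
    in [S] is picked by none of the at most [k] children; [x] is declared dead
    and the optimum matches [v] to [x], so the optimum matches every online
    vertex.  For every node [p] the quantity
    [2 * msize p + #(alive vertices unused by p)] never increases: a child that
    picks a vertex of [S] gains 2, but loses from the count both that vertex and
    [x].  It is [m] at the start, so no node ever exceeds [m / 2], while the
    optimum reaches [m - k * 2 ^ k]. *)

Lemma size_le_fibers (T : eqType) (U : finType) (f : T -> U) (b : nat)
    (s : seq T) :
  (forall u, count (fun x => f x == u) s <= b) -> size s <= b * #|U|.
Proof.
move=> fib; have -> : size s = \sum_(u : U) count (fun x => f x == u) s.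
  elim: s {fib} => [|x s IHs] /=; first by rewrite big1.
  rewrite big_split /= -IHs (bigD1 (f x)) //= eqxx big1 // => u.
  by rewrite eq_sym => /negbTE ->.
rewrite mulnC -sum_nat_const; exact: leq_sum.
Qed.

Lemma big_fiber (T : eqType) (U : finType) (f : T -> U) (b : nat)
    (s : seq T) :
  b * #|U| < size s -> exists u, b < count (fun x => f x == u) s.
Proof.
move=> ltbs; apply/existsP; apply: contraLR ltbs; rewrite negb_exists -leqNgt.
by move/forallP=> H; apply: size_le_fibers (f) _ _ _ => u; rewrite leqNgt.
Qed.

Lemma exists_notin (T : eqType) (s t : seq T) :
  uniq s -> size t < size s -> exists2 x, x \in s & x \notin t.
Proof.
move=> us lts; apply/hasP; apply: contraLR lts => /hasPn H; rewrite -leqNgt.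
by apply: uniq_leq_size => // x /H; rewrite negbK.
Qed.

Lemma all2_rcons (T U : Type) (r : T -> U -> bool) (s : seq T) (t : seq U) x y :
  size s = size t -> all2 r (rcons s x) (rcons t y) = all2 r s t && r x y.
Proof.
elim: s t => [|a s IHs] [|b t] //= => [_|[/IHs ->]]; first by rewrite andbT.
by rewrite andbA.
Qed.

Lemma mem_pmap_some (T : eqType) (s : seq (option T)) (j : T) :
  (j \in pmap id s) = (Some j \in s).
Proof. by rewrite mem_pmap map_id. Qed.

Lemma is_matching_rcons I pm nb d :
  is_matching (rcons I nb) (rcons pm d) =
  [&& is_matching I pm, valid_dec nb d & (d == None) || (d \notin pm)].
Proof.
rewrite /is_matching !size_rcons eqSS; case: eqP => //= sz.
rewrite all2_rcons // -(cats1 pm) pmap_cat cat_uniq.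
case: d => [j|] /=; last by rewrite !andbT.
rewrite orbF andbT mem_pmap_some.
by case: (all2 _ _ _); case: (j \in nb); case: (uniq _); case: (_ \in _).
Qed.

Lemma msize_rcons pm d : msize (rcons pm d) = msize pm + isSome d.
Proof. by rewrite /msize -cats1 count_cat /= addn0. Qed.

Lemma mem_all_decisions I pm :
  is_matching I pm -> pm \in all_decisions I.
Proof.
case/and3P=> /eqP sz val _; elim: I pm sz val => [|nb I IHI] [|d pm] //= [sz].
case/andP=> dnb val; apply/(@allpairsP _ _ _ cons (None :: map Some nb)).
exists (d, pm); split=> //=; last exact: IHI.
by case: d dnb => [j|] //= jnb; rewrite inE map_f.
Qed.

Lemma leq_opt_value I pm : is_matching I pm -> msize pm <= opt_value I.
Proof.
by move=> Ipm; apply: leq_bigmax_seq => //; apply: mem_all_decisions.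
Qed.

(** Level [i] consults only [take i I], so the adversary may fix the next neighbourhood after seeing
    the current level. *)
Lemma level_rcons A m I nb i :
  i <= size I -> level A m (rcons I nb) i = level A m I i.
Proof.
elim: i => //= i IHi lti; rewrite IHi ?(ltnW lti) // -cats1 takel_cat //.
Qed.

Lemma mem_expand L C q :
  q \in expand L C -> exists p d, p \in L /\ q = rcons p d.
Proof.
case/flatten_mapP=> -[p ds] pds /mapP[d _ ->]; exists p, d; split=> //=.
by elim: L C pds => [|p' L IHL] [|c C] //=; rewrite !inE => 
  /orP[/eqP[-> _]|/IHL ->]; rewrite ?eqxx ?orbT.
Qed.

Lemma count_rem1 (T : eqType) (a : pred T) (s : seq T) x :
  x \in s -> a x -> (count a (rem x s)).+1 = count a s.
Proof. by move=> xs ax; rewrite (permP (perm_to_rem xs)) /= ax. Qed.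

Definition unused (p : seq (option nat)) (j : nat) : bool := Some j \notin p.

(** Induction on [n]. Keeping [alive] disjoint from what [opt] uses lets [opt] be extended every
    round; the bound on [m] leaves more than [k * 2 ^ k] alive vertices before each arrival. *)
Lemma adversary (k : nat) (A : Alg) (m n : nat) :
  width_k_alg k A -> n + k * 2 ^ k <= m ->
  exists (I : seq (seq nat)) (alive : seq nat) (opt : seq (option nat)),
    [/\ instance_wf m I /\ size I = n,
        [/\ uniq alive, all (fun j => j < m) alive & size alive = m - n],
        [/\ is_matching I opt, msize opt = n & all (unused opt) alive] &
        {in level A m I n, forall p,
           2 * msize p + count (unused p) alive <= m}].
Proof.
move=> kA; elim: n => [|n IHn] lenm.
  exists [::], (iota 0 m), [::]; split=> //.
  - rewrite iota_uniq size_iota subn0; split=> //.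
    by apply/allP => j; rewrite mem_iota.
  - by split=> //; apply/allP.
  - move=> p; rewrite inE => /eqP ->.
    by rewrite (leq_trans (count_size _ _)) ?size_iota.
have [|I [alive [opt [[wfI szI] [uA ltA szA] [mI szo uo] pot]]]] := IHn.
  by apply: leq_trans lenm; rewrite leq_add2r.
set L := level A m I n in pot.
have szL : size L <= k by have [_] := kA m I wfI; apply; rewrite szI.
(* One bit per node of [L]; as a tuple, the type ranges over a finite set of [2 ^ size L] values. *)
pose type j := [tuple of [seq unused p j | p <- in_tuple L]].
have [t ltk] : exists t, k < count (fun j => type j == t) alive.
  apply: big_fiber; rewrite card_tuple card_bool szA.
  have : k * 2 ^ size L <= k * 2 ^ k by rewrite leq_mul2l leq_exp2l // szL orbT.
  by lia.
pose S := [seq j <- alive | type j == t].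
have SA j : j \in S -> j \in alive by rewrite mem_filter => /andP[].
have typeS : {in L, forall p, {in S &, forall i j, unused p i = unused p j}}.
  move=> p pL i j; rewrite !mem_filter => /andP[/eqP ti _] /andP[/eqP tj _].
  have /eq_in_map : [seq unused q i | q <- L] = [seq unused q j | q <- L].
    by have := congr1 val (etrans ti (esym tj)).
  exact.
have uS : uniq S by rewrite filter_uniq.
have wfI' : instance_wf m (rcons I S).
  rewrite /instance_wf all_rcons -/(instance_wf m I) wfI andbT.
  by apply/allP => j /SA /(allP ltA).
set L' := level A m (rcons I S) n.+1.
have [step bound] := kA m _ wfI'.
have szL' : size L' <= k by apply: bound; rewrite size_rcons szI.
have mL' : all (is_matching (rcons I S)) L'.
  have := step n; rewrite size_rcons szI => /(_ (ltnSn n)) [_ _].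
  by rewrite /L' /= take_oversize // size_rcons szI.
(* The last entry of a node in [L'] is its decision for the new vertex: at most [k] decisions
   against more than [k] elements of [S]. *)
have [x xS xL'] : exists2 x, x \in S &
    Some x \notin [seq last None q | q <- L'].
  have [||_ /mapP[x xS ->] ?] :=
    @exists_notin _ (map Some S) [seq last None q | q <- L'].
  - by rewrite map_inj_uniq // => ? ? [].
  - by rewrite !size_map size_filter (leq_ltn_trans szL').
  - by exists x.
have xA := SA _ xS; have xo : Some x \notin opt := allP uo x xA.
exists (rcons I S), (rem x alive), (rcons opt (Some x)); split.
- by rewrite size_rcons szI.
- rewrite rem_uniq // size_rem // szA -subnS; split=> //.
  by apply/allP => j /mem_rem /(allP ltA).
- rewrite is_matching_rcons mI /= xS xo msize_rcons szo addn1; split=> //.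
  apply/allP => j; rewrite mem_rem_uniq // inE => /andP[jx /(allP uo) jo].
  rewrite /unused mem_rcons inE negb_or; apply/andP; split=> //.
move=> q qL'; have mq := allP mL' q qL'.
have [p [d [pL Eq]]] : exists p d, p \in L /\ q = rcons p d.
  by move: qL'; rewrite /L' /= level_rcons ?szI // => /mem_expand.
have potp := pot p pL.
move: mq; rewrite {}Eq in qL' *; rewrite is_matching_rcons msize_rcons.
case: d qL' => [j|] qL' /and3P[_ /= dS dp].
- have jx : j != x.
    apply: contra xL' => /eqP <-; apply/mapP.
    by exists (rcons p (Some j)); rewrite ?last_rcons.
  (* [p] leaves [j] free, and [x] has the same type as [j], so both count in the potential of
     [p]. *)
  have ux : unused p x by rewrite (typeS p pL x j).
  have potx := count_rem1 _ (unused p) alive x xA ux.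
  have jA : j \in rem x alive by rewrite mem_rem_uniq // inE jx SA.
  have potj := count_rem1 _ (unused p) _ j jA dp.
  have le : count (unused (rcons p (Some j))) (rem x alive)
            <= count (unused p) (rem j (rem x alive)).
    rewrite (permP (perm_to_rem jA)) /= {1}/unused mem_rcons mem_head add0n.
    by apply: sub_count => i; rewrite /unused mem_rcons inE negb_or => /andP[].
  apply: leq_trans potp; rewrite -potx -potj mulnDr -addnA leq_add2l.
  by rewrite muln1 add2n !ltnS.
(* Leaving the vertex unmatched gains nothing, and deleting [x] cannot raise the count. *)
- rewrite (@eq_count _ _ (unused p)) => [|i]; last by rewrite /unused mem_rcons.
  rewrite addn0 (leq_trans _ potp) // leq_add2l.
  by rewrite (permP (perm_to_rem xA)) leq_addl.
Qed.

Theorem theorem6 (k : nat) (A : Alg) :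
  width_k_alg k A -> asymptotic_ratio_le A (1 / 2)%R.
Proof.
move=> kA eps eps0 N; pose K := k * 2 ^ k.
(* Large enough that [K < eps * n]: the ratio is at most [(n + K) / (2 * n)], hence below
   [1 / 2 + eps]. The successor makes [n] positive. *)
pose n := (N + Num.bound (K%:R / eps : rat)%R).+1.
have [I [alive [opt [[wfI szI] _ [mI szo _] pot]]]] :=
  adversary k A (n + K) n kA (leqnn _).
have alg : 2 * alg_value A (n + K) I <= n + K.
  (* Halving first gives a bound on each single node, which passes to the maximum. *)
  suff : alg_value A (n + K) I <= (n + K)./2 by lia.
  rewrite /alg_value szI; apply/bigmax_leqP_seq => p /pot Hp _; lia.
have leopt : n <= opt_value I by rewrite -szo leq_opt_value.
exists (n + K), I; split=> //; first by rewrite szI /n; lia.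
  exact: leq_trans leopt.
have Kn : (K%:R < eps * n%:R :> rat)%R.
  rewrite mulrC -ltr_pdivrMr //.
  apply: lt_le_trans (_ : (Num.bound _)%:R <= _)%R.
    by apply: archi_boundP; rewrite divr_ge0 ?ler0n // ltW.
  by rewrite ler_nat leqW ?leq_addl.
rewrite ltr_pdivrMr; last by rewrite ltr0n (leq_trans _ leopt).
move: alg leopt; rewrite -!(ler_nat rat) natrM natrD => alg leopt.
have epsn : (eps * n%:R <= eps * (opt_value I)%:R)%R by rewrite ler_pM2l.
have K0 : (0 <= K%:R :> rat)%R by rewrite ler0n.
by lra.
Qed.
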